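(* Let $\rho$ be a left-linear constrained rewrite rule. If $\Pi X.\,s\,[\exists\vec{x}.\varphi]\to_\rho \Pi Y.\,t\,[\exists\vec{y}.\psi]$ is a most general rewrite step, then $\mathrm{rmv}(\Pi X.\,s\,[\exists\vec{x}.\varphi])\rightsquigarrow_\rho \mathrm{rmv}(\Pi Y.\,t\,[\exists\vec{y}.\psi])$.
   Context: Fix a many-sorted signature whose sorts are partitioned into theory sorts and term sorts and whose function symbols are partitioned into theory symbols (all argument and result sorts are theory sorts) and term symbols; there is a theory sort $\mathsf{Bool}$. $\mathrm{Var}(t_1,\dots,t_n)$ is the set of variables in the $t_i$; $s|_p$, $s[u]_p$ have the usual meaning. A fixed model $\mathcal{M}$ interprets theory sorts by nonempty sets and theory symbols by functions, with $\mathsf{Bool}=\{\mathsf{true},\mathsf{false}\}$ and standard connectives and equalities; every element of every interpreted sort is a constant theory symbol, called a value; $\mathrm{Val}$ is the set of values. A logical constraint is a $\mathsf{Bool}$-sorted term of theory symbols and variables; $\models_{\mathcal{M},\xi}\varphi$ (valuation $\xi$) and $\models_{\mathcal{M}}\varphi$ (all valuations) as usual. Substitutions are sort-preserving, $\mathrm{Dom}(\sigma)=\{x\mid\sigma(x)\ne x\}$, $\sigma$ is $X$-valued if $\sigma(X)\subseteq\mathrm{Val}$; a renaming is a bijective variable-to-variable substitution. Existential constraint $\exists\vec x.\varphi$: $\{\vec x\}\subseteq\mathrm{Var}(\varphi)$, $\mathrm{FVar}=\mathrm{Var}(\varphi)\setminus\{\vec x\}$, $\mathrm{BVar}=\{\vec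 x\}$; $\models_{\mathcal{M},\xi}\exists\vec x.\varphi$ iff some values $\vec v$ give $\models_{\mathcal{M},\xi}\varphi\{\vec x\mapsto\vec v\}$; valid/satisfiable: for all/some $\xi$. An existentially constrained term $\Pi X.s[\exists\vec x.\varphi]$ requires $\mathrm{FVar}(\exists\vec x.\varphi)\subseteq X\subseteq\mathrm{Var}(s)$ and $\{\vec x\}\cap\mathrm{Var}(s)=\emptyset$; satisfiable if its constraint is. A constrained rewrite rule $\rho:\Pi Z.\ell\to r[\pi]$: $\ell,r$ terms of the same sort, $\pi$ a logical constraint, $(\mathrm{Var}(r)\setminus\mathrm{Var}(\ell))\cup\mathrm{Var}(\pi)\subseteq Z\subseteq\mathrm{Var}(\ell,r,\pi)=\mathrm{Var}(\rho)$; left-linear if $\ell$ is linear; $\mathrm{ExVar}(\rho)=\mathrm{Var}(r)\setminus\mathrm{Var}(\ell)$. A renamed variant of $\rho$ is $\Pi\delta(Z).\ell\delta\to r\delta[\pi\delta]$ for a renaming $\delta$. Most general rewrite step: for satisfiable $\Pi X.s[\exists\vec x.\varphi]$ and left-linear $\rho$ with $\mathrm{Var}(\rho)\cap\mathrm{Var}(s,\varphi)=\emptyset$, if $p\in\mathrm{Pos}(s)$ and $\gamma$ satisfy $\mathrm{Dom}(\gamma)=\mathrm{Var}(\ell)$, $s|_p=\ell\gamma$, $\gamma(x)\in\mathrm{Val}\cup X$ for all $x\in\mathrm{Var}(\ell)\cap Z$, and $\models_{\mathcal{M}}(\exists\vec x.\varphi)\Rightarrow(\exists\vec z.\pi\gamma)$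 with $\{\vec z\}=\mathrm{Var}(\pi)\setminus\mathrm{Var}(\ell)$, then $\Pi X.s[\exists\vec x.\varphi]\to_\rho\Pi Y.t[\exists\vec y.\psi]$ with $t=s[r\gamma]_p$, $\psi=\varphi\land\pi\gamma$, $\{\vec y\}=\mathrm{Var}(\psi)\setminus\mathrm{Var}(t)$, $Y=\mathrm{ExVar}(\rho)\cup(X\cap\mathrm{Var}(t))$. Non-quantified constrained terms: $\Pi X.s[\varphi]$ with $X$ a set of variables, $s$ a term, $\varphi$ a logical constraint, $\mathrm{Var}(\varphi)\subseteq X\subseteq\mathrm{Var}(\varphi,s)$; satisfiable if $\varphi$ is. Write $\sigma\models\varphi$ if $\sigma(\mathrm{Var}(\varphi))\subseteq\mathrm{Val}$ and $\models_{\mathcal{M}}\varphi\sigma$. Equivalence: $\Pi X.s[\varphi]\sim\Pi Y.t[\psi]$ iff for every $X$-valued $\sigma$ with $\sigma\models\varphi$ there is a $Y$-valued $\gamma$ with $\gamma\models\psi$ and $s\sigma=t\gamma$, and vice versa. Rewriting: for satisfiable $\Pi X.s[\varphi]$ and a rule $\rho:\Pi Z.\ell\to r[\pi]$ with $\mathrm{Var}(\rho)\cap(X\cup\mathrm{Var}(s,\varphi))=\emptyset$, $\Pi X.s[\varphi]\to_\rho\Pi Y.t[\varphi]$ if there are a position $p$ of $s$ at which a function symbol occurs and a substitution $\sigma$ with $\mathrm{Dom}(\sigma)=\mathrm{Var}(\ell,r,\pi)$, $\ell\sigma=s|_p$, $\sigma(x)\in\mathrm{Val}\cup X$ for all $x\in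 Z$, $\models_{\mathcal{M}}\varphi\Rightarrow\pi\sigma$, where $t=s[r\sigma]_p$ and $Y=X\cap\mathrm{Var}(t,\varphi)$. Write $u\rightsquigarrow_\rho u'$ for non-quantified terms if $u\sim v\to_{\rho'}v'\sim u'$ for some non-quantified $v,v'$ and some renamed variant $\rho'$ of $\rho$. The existential removing translation is $\mathrm{rmv}(\Pi X.s[\exists\vec x.\varphi])=\Pi(X\cup\{\vec x\}).s[\varphi]$.
   Formalization: Two hypotheses are added, without which the claim fails: all variables in ExVar(ρ) have theory sorts, and a function symbol occurs in s at the position p of the most general rewrite step (automatic when the left-hand side ℓ is not a variable). *)

(* Defs.v *)
From mathcomp Require Import all_boot.
From mathcomp Require Import finmap.

Set Implicit Arguments.
Unset Strict Implicit.
Unset Printing Implicit Defensive.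

Local Open Scope fset_scope.

(* Term sorts and term symbols are the complements of [th_sort] and [th_sym]. *)
Record signature := Signature {
  sort : eqType;
  sym : eqType;
  var : choiceType;
  th_sort : pred sort;
  th_sym : pred sym;
  args : sym -> seq sort;
  res : sym -> sort;
  vsort : var -> sort;
  th_symP : forall f, th_sym f -> th_sort (res f) && all th_sort (args f);
  (* every sort has infinitely many variables *)
  fresh_var : forall (s : sort) (xs : seq var),
    exists2 x, vsort x = s & x \notin xs;

  Bool : sort;
  Bool_th : th_sort Bool;
  s_bool : bool -> sym;
  s_not : sym;
  s_and : sym;
  s_or : sym;
  s_imp : sym;
  s_eq : sort -> sym;
  s_boolP : forall b,
    [/\ th_sym (s_bool b), args (s_bool b) = [::] & res (s_bool b) = Bool];
  s_notP : [/\ th_sym s_not, args s_not = [:: Bool] & res s_not = Bool];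
  s_andP : [/\ th_sym s_and, args s_and = [:: Bool; Bool] & res s_and = Bool];
  s_orP : [/\ th_sym s_or, args s_or = [:: Bool; Bool] & res s_or = Bool];
  s_impP : [/\ th_sym s_imp, args s_imp = [:: Bool; Bool] & res s_imp = Bool];
  s_eqP : forall s, th_sort s ->
    [/\ th_sym (s_eq s), args (s_eq s) = [:: s; s] & res (s_eq s) = Bool]
}.

(* Since every element of an interpreted sort is a constant theory symbol, the
   carrier of a theory sort [s] is taken to be the set of the [v : sym Sg] such
   that [value v] and [res v = s].  [interp f] is only meaningful for a theory
   symbol [f] applied to values of the right sorts. *)
Record model (Sg : signature) := Model {
  value : pred (sym Sg);
  interp : sym Sg -> seq (sym Sg) -> sym Sg;
  valueP : forall v, value v -> th_sym v /\ args v = [::];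
  value_inhabited : forall s : sort Sg, th_sort s ->
    exists2 v, value v & res v = s;
  interpP : forall f vs, th_sym f -> all value vs -> map (@res Sg) vs = args f ->
    value (interp f vs) /\ res (interp f vs) = res f;
  interp_value : forall v, value v -> interp v [::] = v;
  value_Bool : forall v,
    (value v /\ res v = Bool Sg) <-> (exists b, v = s_bool Sg b);
  s_bool_inj : injective (@s_bool Sg);
  interp_not : forall a, interp (s_not Sg) [:: s_bool Sg a] = s_bool Sg (~~ a);
  interp_and : forall a b,
    interp (s_and Sg) [:: s_bool Sg a; s_bool Sg b] = s_bool Sg (a && b);
  interp_or : forall a b,
    interp (s_or Sg) [:: s_bool Sg a; s_bool Sg b] = s_bool Sg (a || b);
  interp_imp : forall a b,
    interp (s_imp Sg) [:: s_bool Sg a; s_bool Sg b] = s_bool Sg (a ==> b);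
  interp_eq : forall s v w, th_sort s -> value v -> value w ->
    res v = s -> res w = s -> interp (s_eq s) [:: v; w] = s_bool Sg (v == w)
}.

Section Terms.
Variable Sg : signature.

(* Raw terms; all the notions below that speak of terms require
   [well_sorted]. *)
Inductive term := Var of var Sg | App of sym Sg & seq term.

Definition sort_of (t : term) : sort Sg :=
  match t with Var x => vsort x | App f _ => res f end.

Fixpoint well_sorted (t : term) : bool :=
  match t with
  | Var _ => true
  | App f ts => all well_sorted ts && (map sort_of ts == args f)
  end.

Fixpoint theory_term (t : term) : bool :=
  match t with
  | Var _ => true
  | App f ts => th_sym f && all theory_term ts
  end.

Definition logical_constraint (phi : term) : bool :=
  [&& well_sorted phi, sort_of phi == Bool Sg & theory_term phi].

Fixpoint var_occs (t : term) : seq (var Sg) :=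
  match t with
  | Var x => [:: x]
  | App _ ts => flatten (map var_occs ts)
  end.

Definition vars (t : term) : {fset var Sg} := [fset x in var_occs t].

Definition linear (t : term) : bool := uniq (var_occs t).

Definition conj (phi psi : term) : term := App (s_and Sg) [:: phi; psi].
Definition impl (phi psi : term) : term := App (s_imp Sg) [:: phi; psi].

(* [subterm_at t p] is [None] when [p] is not a position of [t]; argument
   positions are numbered from 0. *)
Fixpoint subterm_at (t : term) (p : seq nat) : option term :=
  match p, t with
  | [::], _ => Some t
  | i :: q, App f ts => if onth ts i is Some u then subterm_at u q else None
  | _ :: _, Var _ => None
  end.

(* [t[u]_p], for [p] a position of [t] *)
Fixpoint replace_at (t : term) (p : seq nat) (u : term) : term :=
  match p, t with
  | [::], _ => u
  | i :: q, App f ts => App f (set_nth t ts i (replace_at (nth t ts i) q u))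
  | _ :: _, Var _ => t
  end.

Definition fun_pos (t : term) (p : seq nat) : Prop :=
  exists f ts, subterm_at t p = Some (App f ts).

Fixpoint subst (sigma : var Sg -> term) (t : term) : term :=
  match t with
  | Var x => sigma x
  | App f ts => App f (map (subst sigma) ts)
  end.

Definition substitution (sigma : var Sg -> term) : Prop :=
  forall x, well_sorted (sigma x) /\ sort_of (sigma x) = vsort x.

Definition Dom_eq (sigma : var Sg -> term) (A : {fset var Sg}) : Prop :=
  forall x, sigma x <> Var x <-> x \in A.

Definition renaming (delta : var Sg -> var Sg) : Prop :=
  bijective delta /\ forall x, vsort (delta x) = vsort x.

(* [Pi Z. lhs -> rhs [con]] *)
Record rule := Rule {
  rl_Z : {fset var Sg};
  rl_lhs : term;
  rl_rhs : term;
  rl_con : term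
}.

Definition rule_vars (rho : rule) : {fset var Sg} :=
  vars (rl_lhs rho) `|` vars (rl_rhs rho) `|` vars (rl_con rho).

Definition ExVar (rho : rule) : {fset var Sg} :=
  vars (rl_rhs rho) `\` vars (rl_lhs rho).

Definition constrained_rule (rho : rule) : Prop :=
  [/\ well_sorted (rl_lhs rho) /\ well_sorted (rl_rhs rho),
      sort_of (rl_lhs rho) = sort_of (rl_rhs rho),
      logical_constraint (rl_con rho),
      ExVar rho `|` vars (rl_con rho) `<=` rl_Z rho
    & rl_Z rho `<=` rule_vars rho].

Definition left_linear (rho : rule) : bool := linear (rl_lhs rho).

Definition rename_rule (delta : var Sg -> var Sg) (rho : rule) : rule :=
  let d := subst (fun x => Var (delta x)) in
  Rule [fset delta x | x in rl_Z rho]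
       (d (rl_lhs rho)) (d (rl_rhs rho)) (d (rl_con rho)).

(* [Pi X. s [exists xs. phi]]; the tuple of bound variables only matters
   through its underlying set. *)
Record ecterm := ECTerm {
  ec_X : {fset var Sg};
  ec_term : term;
  ec_bvars : {fset var Sg};
  ec_con : term
}.

Definition ec_wf (C : ecterm) : Prop :=
  [/\ well_sorted (ec_term C) /\ logical_constraint (ec_con C),
      ec_bvars C `<=` vars (ec_con C),
      vars (ec_con C) `\` ec_bvars C `<=` ec_X C,
      ec_X C `<=` vars (ec_term C)
    & [disjoint ec_bvars C & vars (ec_term C)]].

(* [Pi X. s [phi]] *)
Record ncterm := NCTerm {
  nc_X : {fset var Sg};
  nc_term : term;
  nc_con : term
}.

Definition nc_wf (u : ncterm) : Prop :=
  [/\ well_sorted (nc_term u), logical_constraint (nc_con u),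
      vars (nc_con u) `<=` nc_X u
    & nc_X u `<=` vars (nc_con u) `|` vars (nc_term u)].

Definition rmv (C : ecterm) : ncterm :=
  NCTerm (ec_X C `|` ec_bvars C) (ec_term C) (ec_con C).

End Terms.

Arguments Var {Sg}.
Arguments App {Sg}.

Section Semantics.
Variables (Sg : signature) (M : model Sg).
Implicit Types (xi : var Sg -> sym Sg) (phi : term Sg) (sigma : var Sg -> term Sg).

(* The value of [xi] at variables of term sorts is irrelevant. *)
Definition valuation xi : Prop :=
  forall x, th_sort (vsort x) -> value M (xi x) /\ res (xi x) = vsort x.

Fixpoint eval xi (t : term Sg) : sym Sg :=
  match t with
  | Var x => xi x
  | App f ts => interp M f (map (eval xi) ts)
  end.

Definition sat xi phi : Prop := eval xi phi = s_bool Sg true.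

Definition valid phi : Prop := forall xi, valuation xi -> sat xi phi.

Definition satisfiable phi : Prop := exists2 xi, valuation xi & sat xi phi.

(* [sat_ex xi xs phi] is the satisfaction of [exists xs. phi] by [xi]; the
   function [v] lists the values substituted for [xs]. *)
Definition sat_ex xi (xs : {fset var Sg}) phi : Prop :=
  exists2 v : var Sg -> sym Sg,
    forall x, x \in xs -> value M (v x) /\ res (v x) = vsort x
    & sat xi (subst (fun x => if x \in xs then App (v x) [::] else Var x) phi).

Definition ec_satisfiable (C : ecterm Sg) : Prop :=
  exists2 xi, valuation xi & sat_ex xi (ec_bvars C) (ec_con C).

Definition in_Val (t : term Sg) : Prop :=
  exists2 v, value M v & t = App v [::].

Definition in_Val_or (X : {fset var Sg}) (t : term Sg) : Prop :=
  in_Val t \/ exists2 x, x \in X & t = Var x.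

Definition valued (X : {fset var Sg}) sigma : Prop :=
  forall x, x \in X -> in_Val (sigma x).

Definition models sigma phi : Prop :=
  valued (vars phi) sigma /\ valid (subst sigma phi).

(* The most general rewrite step at position [p] with substitution [gamma] *)
Definition mg_step_at (rho : rule Sg) (p : seq nat) (gamma : var Sg -> term Sg)
    (C D : ecterm Sg) : Prop :=
  let: Rule Z l r pi := rho in
  let: ECTerm X s xs phi := C in
  let t := replace_at s p (subst gamma r) in
  let psi := conj phi (subst gamma pi) in
  [/\ ec_wf C /\ ec_satisfiable C,
      constrained_rule rho /\ left_linear rho,
      [disjoint rule_vars rho & vars s `|` vars phi],
      [/\ substitution gamma, Dom_eq gamma (vars l),
          subterm_at s p = Some (subst gamma l),
          forall x, x \in vars l `&` Z -> in_Val_or X (gamma x)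
        & forall xi, valuation xi -> sat_ex xi xs phi ->
            sat_ex xi (vars pi `\` vars l) (subst gamma pi)]
    & D = ECTerm (ExVar rho `|` (X `&` vars t)) t (vars psi `\` vars t) psi].

Definition nc_sub (u v : ncterm Sg) : Prop :=
  forall sigma, substitution sigma -> valued (nc_X u) sigma ->
    models sigma (nc_con u) ->
  exists gamma, [/\ substitution gamma, valued (nc_X v) gamma,
    models gamma (nc_con v)
    & subst sigma (nc_term u) = subst gamma (nc_term v)].

Definition nc_equiv (u v : ncterm Sg) : Prop :=
  [/\ nc_wf u, nc_wf v, nc_sub u v & nc_sub v u].

Definition nc_step (rho : rule Sg) (u v : ncterm Sg) : Prop :=
  let: Rule Z l r pi := rho in
  let: NCTerm X s phi := u in
  [/\ nc_wf u, satisfiable phi, constrained_rule rho,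
      [disjoint rule_vars rho & X `|` (vars s `|` vars phi)]
    & exists p sigma, let t := replace_at s p (subst sigma r) in
      [/\ fun_pos s p /\ subterm_at s p = Some (subst sigma l),
          substitution sigma /\ Dom_eq sigma (rule_vars rho),
          forall x, x \in Z -> in_Val_or X (sigma x),
          valid (impl phi (subst sigma pi))
        & v = NCTerm (X `&` (vars t `|` vars phi)) t phi]].

Definition nc_rewrites (rho : rule Sg) (u u' : ncterm Sg) : Prop :=
  exists v v' delta, [/\ renaming delta, nc_equiv u v,
    nc_step (rename_rule delta rho) v v' & nc_equiv v' u'].

End Semantics.

(* Main.v *)
(** Put [chi := phi /\ pi gamma /\ (x = x for x in ExVar rho)].  The entailment in
    the most general step says that every solution of [phi] extends, by choosing
    values for the variables [Var(pi) \ Var(l)], to a solution of [pi gamma]; as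
    the rule variables do not occur in [s], this gives
    [Pi (X + xs). s [phi] ~ Pi (X + xs + Var(chi)). s [chi]].  On the latter an
    ordinary step applies with a variant of [rho] renamed by a fresh [delta] and
    the substitution [delta x |-> gamma x], because [chi] entails [pi gamma]
    trivially and contains every variable that the step has to instantiate.
    The result differs from the translation of the most general reduct only by
    the equations [x = x]. *)

Require Import Defs.
From mathcomp Require Import all_boot.
From mathcomp Require Import finmap.

Set Implicit Arguments.
Unset Strict Implicit.
Unset Printing Implicit Defensive.

Local Open Scope fset_scope.

(** * Substitutions and variables of terms *)

Section TermLemmas.
Variable Sg : signature.
Implicit Types (t u phi psi : term Sg) (sigma tau : var Sg -> term Sg).

(** The generated principle gives no hypothesis on the arguments nested in a [seq]. Folding the
    hypotheses into a conjunction lets an inner induction on the argument list take them one by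
    one. *)
Lemma term_nested_ind (P : term Sg -> Prop) :
    (forall x, P (Var x)) ->
    (forall f ts, foldr (fun t Q => P t /\ Q) True ts -> P (App f ts)) ->
  forall t, P t.
Proof.
move=> HV HA; fix IH 1; case=> [x|f ts]; first exact: HV.
apply: HA; elim: ts => [|t ts IHts]; first exact: I.
by split; [exact: IH | exact: IHts].
Qed.

Lemma in_vars t x : (x \in vars t) = (x \in var_occs t).
Proof. by rewrite /vars in_fset. Qed.

Lemma vars_Var x y : (y \in vars (Var x : term Sg)) = (y == x).
Proof. by rewrite in_vars inE. Qed.

Lemma vars_App f ts x :
  (x \in vars (App f ts : term Sg)) = has (fun t => x \in vars t) ts.
Proof.
rewrite in_vars /=; elim: ts => //= t ts IH.
by rewrite mem_cat IH in_vars.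
Qed.

Lemma eq_subst sigma tau t :
  {in vars t, sigma =1 tau} -> subst sigma t = subst tau t.
Proof.
elim/term_nested_ind: t => [x|f ts IH] Hst /=.
  by apply: Hst; rewrite vars_Var.
congr App; have {}Hst x : has (fun t => x \in vars t) ts -> sigma x = tau x.
  by rewrite -(vars_App f); apply: Hst.
elim: ts IH Hst => //= t ts IHts [Ht Hts] Hst; congr cons.
  by apply: Ht => x xt; apply: Hst; rewrite xt.
by apply: IHts => // x xt; apply: Hst; rewrite xt orbT.
Qed.

Lemma subst_comp sigma tau t :
  subst sigma (subst tau t) = subst (fun x => subst sigma (tau x)) t.
Proof.
elim/term_nested_ind: t => [//|f ts IH] /=; congr App.
by elim: ts IH => //= t ts IHts [-> Hts]; rewrite IHts.
Qed.

Lemma vars_subst sigma t y :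
  reflect (exists2 x, x \in vars t & y \in vars (sigma x))
          (y \in vars (subst sigma t)).
Proof.
apply: (iffP idP).
  elim/term_nested_ind: t => [x|f ts IH] /=.
    by exists x => //; rewrite vars_Var.
  rewrite vars_App => Hy.
  suff [x xt yx] : exists2 x, has (fun t => x \in vars t) ts
                              & y \in vars (sigma x).
    by exists x => //; rewrite vars_App.
  elim: ts IH Hy => //= t ts IHts [Ht Hts] /orP[/Ht[x xt yx]|/(IHts Hts)[x xt yx]].
    by exists x => //; rewrite xt.
  by exists x => //; rewrite xt orbT.
case=> x + yx; elim/term_nested_ind: t => [z|f ts IH] /=.
  by rewrite vars_Var => /eqP <-.
rewrite !vars_App; elim: ts IH => //= t ts IHts [Ht Hts] /orP[/Ht->//|/(IHts Hts)->].
by rewrite orbT.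
Qed.

Lemma sort_of_subst sigma t : substitution sigma ->
  sort_of (subst sigma t) = sort_of t.
Proof. by case: t => [x|f ts] Hs //=; case: (Hs x). Qed.

Lemma well_sorted_subst sigma t : substitution sigma ->
  well_sorted t -> well_sorted (subst sigma t).
Proof.
move=> Hs; elim/term_nested_ind: t => [x|f ts IH] /=; first by case: (Hs x).
case/andP=> Hts /eqP <-.
rewrite -map_comp (eq_map (g := @sort_of Sg)) ?eqxx ?andbT; last first.
  by move=> t /=; rewrite sort_of_subst.
by elim: ts IH Hts => //= t ts IHts [Ht /IHts Hts] /andP[/Ht-> /Hts->].
Qed.

Lemma theory_term_subst sigma t :
    {in vars t, forall x, theory_term (sigma x)} ->
  theory_term t -> theory_term (subst sigma t).
Proof.
elim/term_nested_ind: t => [x|f ts IH] Hs /=.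
  by move=> _; apply: Hs; rewrite vars_Var.
case/andP=> -> /=.
have {}Hs x : has (fun t => x \in vars t) ts -> theory_term (sigma x).
  by rewrite -(vars_App f); apply: Hs.
elim: ts IH Hs => //= t ts IHts [Ht Hts] Hs /andP[tt tts]; apply/andP; split.
  by apply: Ht => // x xt; apply: Hs; rewrite xt.
by apply: IHts => // x xt; apply: Hs; rewrite xt orbT.
Qed.

Lemma logical_constraint_subst sigma phi : substitution sigma ->
    {in vars phi, forall x, theory_term (sigma x)} ->
  logical_constraint phi -> logical_constraint (subst sigma phi).
Proof.
move=> Hs Ht /and3P[wphi /eqP sphi tphi]; apply/and3P; split.
- exact: well_sorted_subst.
- by rewrite sort_of_subst // sphi.
- exact: theory_term_subst.
Qed.

(** * Positions and replacement *)

Lemma onth_nth (T : Type) (x0 : T) (s : seq T) i (u : T) :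
  onth s i = Some u -> i < size s /\ nth x0 s i = u.
Proof.
elim: s i => [|a s IH] [|i] //=; first by case.
by move=> /IH.
Qed.

Lemma has_onth (T : Type) (a : pred T) (s : seq T) i (u : T) :
  onth s i = Some u -> a u -> has a s.
Proof.
elim: s i => [|b s IH] [|i] //=; first by case=> -> ->.
by move=> /IH H /H ->; rewrite orbT.
Qed.

(** The bound keeps [set_nth] from padding with [x0], on which [a] might hold. *)
Lemma has_set_nth (T : Type) (a : pred T) x0 (s : seq T) i (u : T) : i < size s ->
  has a (set_nth x0 s i u) -> has a s || a u.
Proof.
elim: s i => [|b s IH] [|i] //=.
  by move=> _ /orP[->|->]; rewrite ?orbT.
by move=> /IH{}IH /orP[->//|/IH]; rewrite -orbA => ->; rewrite orbT.
Qed.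

Lemma set_nth_has (T : Type) (a : pred T) x0 (s : seq T) i (u : T) :
  i < size s -> a u -> has a (set_nth x0 s i u).
Proof.
elim: s i => [|b s IH] [|i] //=; first by move=> _ ->.
by move=> /IH H /H ->; rewrite orbT.
Qed.

Lemma vars_subterm t p u : subterm_at t p = Some u -> vars u `<=` vars t.
Proof.
elim: p t => [|i p IH] t /=; first by case: t => [x|f ts] [->].
case: t => [//|f ts]; case E: (onth ts i) => [v|//] /IH /fsubsetP Huv.
by apply/fsubsetP => x /Huv xv; rewrite vars_App; exact: has_onth E xv.
Qed.

Lemma vars_replace_at_sub t p u v : subterm_at t p = Some v ->
  vars (replace_at t p u) `<=` vars t `|` vars u.
Proof.
elim: p t => [|i p IH] t /=.
  by move=> _; case: t => *; exact: fsubsetUr.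
case: t => [//|f ts]; case E: (onth ts i) => [w|//] /IH /fsubsetP Hw.
have [lti nthw] := onth_nth (App f ts) E.
apply/fsubsetP => x; rewrite in_fsetU !vars_App => /(has_set_nth lti)/orP[->//|].
rewrite nthw => /Hw; rewrite in_fsetU => /orP[xw|->]; last by rewrite orbT.
by rewrite (has_onth E).
Qed.

Lemma vars_replace_at_sup t p u v : subterm_at t p = Some v ->
  vars u `<=` vars (replace_at t p u).
Proof.
elim: p t => [|i p IH] t /=; first by case: t.
case: t => [//|f ts]; case E: (onth ts i) => [w|//] /IH /fsubsetP Hw.
have [lti nthw] := onth_nth (App f ts) E.
apply/fsubsetP => x xu; rewrite vars_App; apply: set_nth_has => //.
by rewrite nthw; apply: Hw.
Qed.

(** The sort is tracked along with well-sortedness because the symbol above the replaced argument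
    rechecks its argument sorts. *)
Lemma replace_at_sorted t p u v :
    subterm_at t p = Some v -> sort_of v = sort_of u ->
    well_sorted t -> well_sorted u ->
  well_sorted (replace_at t p u) /\ sort_of (replace_at t p u) = sort_of t.
Proof.
move=> + Hvu; elim: p t => [|i p IH] t /=.
  by case: t => [x|f ts] [Ev] _ wu; split=> //; rewrite -Hvu -Ev.
case: t => [//|f ts]; case E: (onth ts i) => [w|//] Hw.
have [lti nthw] := onth_nth (App f ts) E.
move=> /= /andP[wts /eqP <-] wu; split=> //.
have ww : well_sorted w.
  by rewrite -nthw; apply: all_nthP lti; apply: wts.
have [wr sr] := IH _ Hw ww wu; rewrite nthw.
move: (replace_at w p u) wr sr => r wr sr; move: (App f ts) => d in nthw *.
rewrite {E Hw}.
elim: ts i lti nthw wts => [|a ts IHts] [|i] //=.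
  by move=> _ -> /andP[_ ->]; rewrite wr sr eqxx.
move=> lti nthw /andP[-> wts].
by have /andP[-> /eqP ->] := IHts i lti nthw wts; rewrite eqxx.
Qed.

(** * Conjunctions and trivial equations *)

Lemma logical_constraint_conj phi psi :
  logical_constraint phi -> logical_constraint psi ->
  logical_constraint (Defs.conj phi psi).
Proof.
case/and3P=> w1 /eqP s1 t1 /and3P[w2 /eqP s2 t2].
have [th ar rs] := s_andP Sg.
by apply/and3P; rewrite /= w1 w2 s1 s2 t1 t2 th ar rs !eqxx.
Qed.

Lemma vars_conj phi psi : vars (Defs.conj phi psi) = vars phi `|` vars psi.
Proof. by apply/fsetP => x; rewrite vars_App /= orbF in_fsetU. Qed.

(* A non-quantified step may map the extra variables of a rule only to values or
   to variables of [X], hence of the constraint or the term; the trivial equations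
   [x = x] bring them into the constraint without changing its meaning. *)
Definition conj_refl (xs : seq (var Sg)) phi : term Sg :=
  foldr (fun x psi => Defs.conj psi (App (s_eq (vsort x)) [:: Var x; Var x]))
        phi xs.

Lemma logical_constraint_conj_refl xs phi :
    {in xs, forall x, th_sort (vsort x)} ->
  logical_constraint phi -> logical_constraint (conj_refl xs phi).
Proof.
elim: xs => //= x xs IH Hxs Hphi; apply: logical_constraint_conj.
  by apply: IH => // y yxs; apply: Hxs; rewrite inE yxs orbT.
have [th ar rs] := s_eqP (Hxs x (mem_head _ _)).
by apply/and3P; rewrite /= th ar rs !eqxx.
Qed.

Lemma vars_conj_refl xs phi y :
  (y \in vars (conj_refl xs phi)) = (y \in vars phi) || (y \in xs).
Proof.
elim: xs => [|x xs IH] /=; first by rewrite orbF.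
rewrite vars_conj in_fsetU IH vars_App /= !vars_Var inE orbF orbb -orbA.
by congr orb; rewrite orbC.
Qed.

End TermLemmas.

(** * Renamings and rule variants *)

Section Renaming.
Variable Sg : signature.
Implicit Types (delta : var Sg -> var Sg) (rho : rule Sg) (t : term Sg).

Lemma renaming_substitution delta : renaming delta ->
  substitution (fun x => Var (delta x)).
Proof. by case=> _ Hs x; split; last exact: Hs. Qed.

Lemma vars_rename delta t :
  vars (subst (fun x => Var (delta x)) t) = delta @` vars t.
Proof.
apply/fsetP => y; apply/vars_subst/imfsetP => /= -[x xt].
  by rewrite vars_Var => /eqP ->; exists x.
by move=> ->; exists x; rewrite ?vars_Var.
Qed.

Lemma rule_vars_rename delta rho :
  rule_vars (rename_rule delta rho) = delta @` rule_vars rho.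
Proof. by case: rho => Z l r c; rewrite /rule_vars /= !vars_rename !imfsetU. Qed.

Lemma constrained_rule_rename delta rho : renaming delta ->
  constrained_rule rho -> constrained_rule (rename_rule delta rho).
Proof.
move=> Hd; have Hsub := renaming_substitution Hd.
have injd : injective delta by case: Hd => /bij_inj.
case=> -[wl wr] slr lc Hex HZ; split.
- by split; apply: well_sorted_subst.
- by rewrite !sort_of_subst.
- exact: logical_constraint_subst.
- apply/fsubsetP => y; rewrite in_fsetU in_fsetD !vars_rename => /orP[|].
    case/andP=> yl /imfsetP[/= x xr Ey]; apply/imfsetP; exists x => //=.
    apply: (fsubsetP Hex); rewrite in_fsetU in_fsetD xr andbT.
    by apply/orP; left; apply: contra yl => xl; rewrite Ey; apply: in_imfset.
  case/imfsetP=> /= x xc ->; apply: in_imfset => /=.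
  by apply: (fsubsetP Hex); rewrite in_fsetU xc orbT.
- rewrite rule_vars_rename; apply/fsubsetP => y /imfsetP[/= x xZ ->].
  by apply: in_imfset; apply: (fsubsetP HZ).
Qed.

(** Since a renaming is a bijection of all variables, it is built as a composition of
    transpositions, each exchanging one variable of [xs] with a fresh one of the same sort. *)
Lemma fresh_renaming (xs B : seq (var Sg)) :
  exists2 delta, renaming delta & {in xs, forall x, delta x \notin B}.
Proof.
(* Keeping a finite [S] outside which [delta] is the identity allows the next fresh [y] to be chosen
   with [delta y = y]. *)
suff [delta [S [Hd HS HB]]] : exists delta (S : seq (var Sg)),
    [/\ renaming delta, forall x, x \notin S -> delta x = x
      & {in xs, forall x, delta x \notin B}] by exists delta.
elim: xs => [|x xs [delta [S [[bd sd] HS HB]]]].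
  by exists id, [::]; split=> //; split=> //; exists id.
have [xxs|xxs] := boolP (x \in xs).
  by exists delta, S; split=> // y; rewrite inE => /predU1P[->|]; apply: HB.
have [y sy] := fresh_var (vsort x) (x :: S ++ B ++ xs).
rewrite inE !mem_cat !negb_or => /and4P[yx yS yB yxs].
pose swap z := if z == x then y else if z == y then x else z.
have swapK : involutive swap.
  move=> z; rewrite /swap; case: (eqVneq z x) => [->|zx].
    by rewrite (negPf yx) eqxx.
  case: (eqVneq z y) => [->|zy]; first by rewrite eqxx.
  by rewrite (negPf zx) (negPf zy).
exists (delta \o swap), (x :: y :: S); split.
- split; first by apply: bij_comp => //; exists swap.
  move=> z /=; rewrite sd /swap.
  by case: eqP => [->//|_]; case: eqP => [->|].
- move=> z; rewrite !inE !negb_or /= /swap => /and3P[/negPf-> /negPf-> zS].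
  exact: HS.
- move=> z; rewrite inE /= /swap => /predU1P[->|zxs].
    by rewrite eqxx HS.
  case: eqP => [zx|_]; first by rewrite -zx zxs in xxs.
  case: eqP => [zy|_]; first by rewrite -zy zxs in yxs.
  exact: HB.
Qed.

(** Take [tau] after the inverse of [delta] on the image of [A], and the identity elsewhere. The
    last hypothesis prevents any variable of the image from being fixed, so the domain is the whole
    image. *)
Lemma transport_substitution delta (A : {fset var Sg}) (tau : var Sg -> term Sg) :
    renaming delta -> substitution tau ->
    {in A, forall x, tau x <> Var (delta x)} ->
  exists sigma, [/\ substitution sigma, Dom_eq sigma (delta @` A)
    & {in A, forall x, sigma (delta x) = tau x}].
Proof.
move=> [[d dK Kd] sd] Htau Hne.
pose sigma y := if y \in delta @` A then tau (d y) else Var y.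
have sigmaE : {in A, forall x, sigma (delta x) = tau x}.
  by move=> x xA; rewrite /sigma dK in_imfset.
exists sigma; split=> //.
- move=> y; rewrite /sigma; case: ifP => // /imfsetP[/= x xA ->].
  by rewrite dK sd; apply: Htau.
- move=> y; split; last by case/imfsetP => /= x xA ->; rewrite sigmaE //; exact: Hne.
  by rewrite /sigma; case: ifP.
Qed.

End Renaming.

(** * Evaluation, satisfaction, and substitutions read as valuations *)

Section SemanticsLemmas.
Variables (Sg : signature) (M : model Sg).
Implicit Types (t phi psi : term Sg) (sigma tau : var Sg -> term Sg).
Implicit Types (xi : var Sg -> sym Sg) (xs : {fset var Sg}).

Lemma eval_subst xi sigma t :
  eval M xi (subst sigma t) = eval M (fun x => eval M xi (sigma x)) t.
Proof.
elim/term_nested_ind: t => [//|f ts IH] /=; congr (interp M f).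
by elim: ts IH => //= t ts IHts [-> Hts]; rewrite IHts.
Qed.

Lemma eq_eval xi xi' t : {in vars t, xi =1 xi'} -> eval M xi t = eval M xi' t.
Proof.
elim/term_nested_ind: t => [x|f ts IH] Hxi /=.
  by apply: Hxi; rewrite vars_Var.
congr (interp M f).
have {}Hxi x : has (fun t => x \in vars t) ts -> xi x = xi' x.
  by rewrite -(vars_App f); apply: Hxi.
elim: ts IH Hxi => //= t ts IHts [Ht Hts] Hxi; congr cons.
  by apply: Ht => x xt; apply: Hxi; rewrite xt.
by apply: IHts => // x xt; apply: Hxi; rewrite xt orbT.
Qed.

Lemma eval_sorted xi t : valuation M xi ->
    well_sorted t -> theory_term t -> th_sort (sort_of t) ->
  value M (eval M xi t) /\ res (eval M xi t) = sort_of t.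
Proof.
move=> Hxi; elim/term_nested_ind: t => [x|f ts IH] /=; first by move=> *; apply: Hxi.
case/andP=> wts /eqP Hargs /andP[thf tts] _.
have /andP[_] := th_symP thf; rewrite -Hargs => thargs.
suff [Hval Hres] : all (value M) (map (eval M xi) ts) /\
    map (@res Sg) (map (eval M xi) ts) = map (@sort_of Sg) ts.
  by apply: interpP; rewrite // Hres Hargs.
elim: ts IH wts tts thargs {Hargs} => //= t ts IHts [Ht Hts].
move=> /andP[wt wts] /andP[tt tts] /andP[st sts].
have [-> ->] := Ht wt tt st.
by have [-> ->] := IHts Hts wts tts sts.
Qed.

Lemma eval_bool xi phi : valuation M xi -> logical_constraint phi ->
  exists b, eval M xi phi = s_bool Sg b.
Proof.
move=> Hxi /and3P[wphi /eqP sphi tphi]; apply/(value_Bool M).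
by rewrite -sphi; apply: eval_sorted => //; rewrite sphi Bool_th.
Qed.

Lemma sat_conj xi phi psi : valuation M xi ->
    logical_constraint phi -> logical_constraint psi ->
  sat M xi (Defs.conj phi psi) <-> sat M xi phi /\ sat M xi psi.
Proof.
move=> Hxi /(eval_bool Hxi)[a Ea] /(eval_bool Hxi)[b Eb].
rewrite /sat /= Ea Eb interp_and; split=> [/(@s_bool_inj _ M)/andP[-> ->] //|].
by case=> /(@s_bool_inj _ M) -> /(@s_bool_inj _ M) ->.
Qed.

Lemma sat_impl xi phi psi : valuation M xi ->
    logical_constraint phi -> logical_constraint psi ->
  sat M xi (impl phi psi) <-> (sat M xi phi -> sat M xi psi).
Proof.
move=> Hxi /(eval_bool Hxi)[a Ea] /(eval_bool Hxi)[b Eb].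
rewrite /sat /= Ea Eb interp_imp; split.
  by move=> /(@s_bool_inj _ M)/implyP H /(@s_bool_inj _ M)/H ->.
by case: a {Ea} => [->//|_].
Qed.

(** At a theory sort [xi x] is a value, so the interpreted equality makes [x = x] true. *)
Lemma sat_conj_refl xi (xs : seq (var Sg)) phi : valuation M xi ->
    {in xs, forall x, th_sort (vsort x)} -> logical_constraint phi ->
  sat M xi (conj_refl xs phi) <-> sat M xi phi.
Proof.
move=> Hxi Hxs Hphi; elim: xs Hxs => //= x xs IH Hxs.
have Hxs' : {in xs, forall x, th_sort (vsort x)}.
  by move=> y yxs; apply: Hxs; rewrite inE yxs orbT.
have thx := Hxs x (mem_head _ _).
have [th ar rs] := s_eqP thx.
have lx : logical_constraint (App (s_eq (vsort x)) [:: Var x; Var x]).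
  by apply/and3P; rewrite /= th ar rs !eqxx.
rewrite sat_conj // ?IH //; last exact: logical_constraint_conj_refl.
split=> [[]//|]; split=> //; have [vx rx] := Hxi _ thx.
by rewrite /sat /= (interp_eq thx) // eqxx.
Qed.

Definition override (xs : {fset var Sg}) (v xi : var Sg -> sym Sg) x :=
  if x \in xs then v x else xi x.

Lemma override_valuation xs (v : var Sg -> sym Sg) xi :
    (forall x, x \in xs -> value M (v x) /\ res (v x) = vsort x) ->
  valuation M xi -> valuation M (override xs v xi).
Proof. by move=> Hv Hxi x thx; rewrite /override; case: ifP => [/Hv|_]; auto. Qed.

Lemma eval_value xi v : value M v -> eval M xi (App v [::]) = v.
Proof. exact: interp_value. Qed.

(** A value evaluates to itself, so substituting values for the bound variables amounts to changing
    the valuation there. *)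
Lemma sat_exP xi xs phi :
  sat_ex M xi xs phi <->
  exists2 v, forall x, x \in xs -> value M (v x) /\ res (v x) = vsort x
           & sat M (override xs v xi) phi.
Proof.
have E v : (forall x, x \in xs -> value M (v x) /\ res (v x) = vsort x) ->
    eval M xi (subst (fun x => if x \in xs then App (v x) [::] else Var x) phi)
    = eval M (override xs v xi) phi.
  move=> Hv; rewrite eval_subst; apply: eq_eval => x _ /=.
  by rewrite /override; case: ifP => // /Hv[vx _]; exact: eval_value.
by split=> -[v Hv Hsat]; exists v; rewrite // /sat -?(E v Hv) // (E v Hv).
Qed.

(** Reads off the values assigned by [sigma]; the fallback [xi] makes the result a valuation even
    where [sigma] assigns no value. *)
Definition ground xi sigma x : sym Sg :=
  if sigma x is App f [::] then if value M f then f else xi x else xi x.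

Lemma ground_valuation xi sigma :
  valuation M xi -> substitution sigma -> valuation M (ground xi sigma).
Proof.
move=> Hxi Hs x thx; rewrite /ground; have [_] := Hs x.
case: (sigma x) => [y|f [|t ts]] /=; try by move=> _; apply: Hxi.
by case: ifP => // _ _; apply: Hxi.
Qed.

Lemma ground_value xi sigma x v :
  value M v -> sigma x = App v [::] -> ground xi sigma x = v.
Proof. by rewrite /ground => Hv ->; rewrite Hv. Qed.

Lemma ground_in_Val xi sigma x : substitution sigma -> in_Val M (sigma x) ->
  [/\ sigma x = App (ground xi sigma x) [::], value M (ground xi sigma x)
    & res (ground xi sigma x) = vsort x].
Proof.
move=> Hs [v Hv Ev]; rewrite (ground_value _ Hv Ev); split=> //.
by have [_ <-] := Hs x; rewrite Ev.
Qed.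

(** The instance of [phi] has no variables left, so neither [xi] nor the fallback [xi'] affects its
    truth. *)
Lemma sat_subst_ground xi xi' sigma phi : substitution sigma ->
  valued M (vars phi) sigma ->
  sat M xi (subst sigma phi) <-> sat M (ground xi' sigma) phi.
Proof.
move=> Hs Hv; rewrite /sat eval_subst.
rewrite (eq_eval (xi' := ground xi' sigma)) // => x /Hv /(ground_in_Val xi' Hs).
by case=> -> Hval _; rewrite eval_value // (ground_value _ Hval).
Qed.

Lemma models_ground xi sigma phi :
    valuation M xi -> substitution sigma ->
  models M sigma phi <-> valued M (vars phi) sigma /\ sat M (ground xi sigma) phi.
Proof.
move=> Hxi Hs; split=> -[Hv Hsat]; split=> //.
  by have /(sat_subst_ground _ xi Hs Hv) := Hsat _ Hxi.
by move=> xi' _; apply/(sat_subst_ground _ xi Hs Hv).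
Qed.

(** The witness is the given substitution itself. This settles every inclusion that only weakens the
    constraint; [xi] merely supplies fallback values. *)
Lemma nc_sub_con xi (u v : ncterm Sg) : valuation M xi ->
    vars (nc_con v) `<=` nc_X v -> nc_X v `<=` nc_X u -> nc_term u = nc_term v ->
    (forall xi', valuation M xi' -> sat M xi' (nc_con u) -> sat M xi' (nc_con v)) ->
  nc_sub M u v.
Proof.
move=> Hxi /fsubsetP Hcon /fsubsetP HX Et Hsat sigma Hs Hval.
case/(models_ground _ Hxi Hs) => _ Hu; exists sigma; split=> //.
- by move=> x /HX; apply: Hval.
- apply/(models_ground _ Hxi Hs); split; first by move=> x /Hcon/HX; apply: Hval.
  by apply: Hsat => //; apply: ground_valuation.
- by rewrite Et.
Qed.

End SemanticsLemmas.

Theorem mainTheorem2 (Sg : signature) (M : model Sg) (rho : rule Sg)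
    (hrho : constrained_rule rho) (hll : left_linear rho)
    (hEx : forall x, x \in ExVar rho -> th_sort (vsort x))
    (C D : ecterm Sg) (p : seq nat) (gamma : var Sg -> term Sg)
    (hp : fun_pos (ec_term C) p)
    (hstep : mg_step_at M rho p gamma C D) :
  nc_rewrites M rho (rmv C) (rmv D).
Proof.
case: rho hrho hll hEx hstep => Z l r pi hrho _ hEx.
case: C hp => X s xs phi /= hp.
set t := replace_at s p _; set pig := subst gamma pi.
case=> -[[[ws lcphi] /= xsphi phiX Xs xsS] [xi0 Hxi0 Hsat0]] _ Hdisj.
case=> Hg Hdom Hsp HZ Himp ->.
set E := ExVar _ in hEx *; set psi := Defs.conj phi pig.
set zs := vars pi `\` vars l in Himp.
have in_E x : (x \in E) = (x \notin vars l) && (x \in vars r) by rewrite in_fsetD.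
clearbody E.
case: (hrho) => /= -[wl wr] slr lcpi HexZ ZV.
have gid x : x \notin vars l -> gamma x = Var x.
  move=> xl; have := Hdom x; case: (gamma x) => [y|f ts] [H _].
    have [->//|yx] := eqVneq y x.
    by case/negP: xl; apply: H => -[] /eqP; rewrite (negPf yx).
  by case/negP: xl; apply: H.
have fresh x : x \in rule_vars (Rule Z l r pi) ->
    (x \notin vars s) * (x \notin vars phi).
  move=> xr; have /fdisjointP/(_ _ xr) := Hdisj.
  by rewrite in_fsetU negb_or => /andP[-> ->].
have piZ x : x \in vars pi -> x \in Z.
  by move=> xpi; apply: (fsubsetP HexZ); rewrite in_fsetU xpi orbT.
have zsR x : x \in zs -> x \in rule_vars (Rule Z l r pi).
  by rewrite in_fsetD => /andP[_ xpi]; rewrite /rule_vars !in_fsetU xpi orbT.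
have ER x : x \in E -> x \in rule_vars (Rule Z l r pi).
  by rewrite in_E => /andP[_ xr]; rewrite /rule_vars !in_fsetU xr orbT.
(* As [Var(pi)] lies in [Z], the step condition covers the variables shared with [l]; [gamma] fixes
   the others. Hence [pig] is a logical constraint over [X] and [zs]. *)
have gpi x : x \in vars pi -> in_Val_or M X (gamma x) \/ (x \in zs /\ gamma x = Var x).
  move=> xpi; have [xl|xl] := boolP (x \in vars l); last first.
    by right; rewrite in_fsetD xl xpi gid.
  by left; apply: HZ; rewrite in_fsetI xl piZ.
have lcpig : logical_constraint pig.
  apply: logical_constraint_subst => // x /gpi[[[v /valueP[tv _] ->]|[y _ ->]]|[_ ->]] //=.
  by rewrite tv.
have varspig x : x \in vars pig -> x \in X \/ x \in zs.
  case/vars_subst=> y /gpi[[[v _ ->]|[z zX ->]]|[yzs ->]].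
  - by rewrite vars_App.
  - by rewrite vars_Var => /eqP ->; left.
  - by rewrite vars_Var => /eqP ->; right.
have lcpsi : logical_constraint psi by apply: logical_constraint_conj.
pose chi := conj_refl (enum_fset E) psi.
have hEx' : {in enum_fset E, forall x, th_sort (vsort x)} by [].
have lcchi : logical_constraint chi by apply: logical_constraint_conj_refl.
have varschi x : (x \in vars chi) = [|| x \in vars phi, x \in vars pig | x \in E].
  by rewrite vars_conj_refl vars_conj in_fsetU -orbA.
have satchi xi : valuation M xi ->
    sat M xi chi <-> sat M xi phi /\ sat M xi pig.
  by move=> Hxi; rewrite sat_conj_refl // sat_conj.
have phiU x : x \in vars phi -> x \in X `|` xs.
  move=> xphi; rewrite in_fsetU; have [_|nxs] := boolP (x \in xs).
    by rewrite orbT.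
  by rewrite (fsubsetP phiX) // in_fsetD nxs.
have [wt _] : well_sorted t /\ sort_of t = sort_of s.
  apply: replace_at_sorted Hsp _ ws _; first by rewrite !sort_of_subst.
  exact: well_sorted_subst.
have Et x : x \in E -> x \in vars t.
  rewrite in_E => /andP[xl xr]; apply: (fsubsetP (vars_replace_at_sup _ Hsp)).
  by apply/vars_subst; exists x; rewrite ?gid ?vars_Var.
have tE x : x \in vars t -> x \in vars s \/ x \in E.
  move/(fsubsetP (vars_replace_at_sub _ Hsp)); rewrite in_fsetU => /orP[|]; first by left.
  case/vars_subst=> y yr xy; have [yl|yl] := boolP (y \in vars l).
    left; apply: (fsubsetP (vars_subterm Hsp)).
    by apply/vars_subst; exists y.
  by move: xy; rewrite gid // vars_Var => /eqP ->; right; rewrite in_E yl.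
have XphiR x : x \in X `|` xs -> x \in rule_vars (Rule Z l r pi) -> False.
  move=> + /fresh[xs' xphi]; rewrite in_fsetU => /orP[/(fsubsetP Xs)|/(fsubsetP xsphi)].
    by rewrite (negPf xs').
  by rewrite (negPf xphi).

(* Variable sets and well-formedness of the intermediate terms *)
pose U := X `|` xs `|` vars chi.
(* The intermediate reduct gets the variable set of [rmv D]. The delicate case is a variable of [t]
   outside [E] and [X]: it comes from [s], so it avoids [xs], [phi] and [pig], hence [U]. *)
have EU : U `&` (vars t `|` vars chi) = E `|` (X `&` vars t) `|` (vars psi `\` vars t).
  apply/fsetP => x; rewrite !(in_fsetU, in_fsetI, in_fsetD) varschi vars_conj in_fsetU.
  have [xE|xE] := boolP (x \in E); first by rewrite (Et x xE) !orbT.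
  rewrite !orbF /=; have [xt|xt] := boolP (x \in vars t); rewrite /= ?andbT ?orbF ?andbF /=.
    have [xX|xX] //= := boolP (x \in X).
    have xins : x \in vars s by case: (tE _ xt) => // xE'; rewrite xE' in xE.
    have xnxs : x \notin xs.
      by apply/negP => H; have /fdisjointP/(_ _ H) := xsS; rewrite xins.
    have xnphi : x \notin vars phi.
      by apply/negP => /phiU; rewrite in_fsetU (negPf xX) (negPf xnxs).
    have xnpig : x \notin vars pig.
      apply/negP => /varspig[|/zsR/fresh[]]; first by rewrite (negPf xX).
      by rewrite xins.
    by rewrite (negPf xnxs) (negPf xnphi) (negPf xnpig).
  by case: ((x \in vars phi) || (x \in vars pig)); rewrite ?orbT ?andbF.
have wfC : nc_wf (NCTerm (X `|` xs) s phi).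
  split=> //=; first by apply/fsubsetP.
  apply/fsubsetP => x; rewrite !in_fsetU => /orP[/(fsubsetP Xs)|/(fsubsetP xsphi)] ->;
    by rewrite ?orbT.
have wfv : nc_wf (NCTerm U s chi).
  split=> //=; first exact: fsubsetUr.
  apply/fsubsetP => x; rewrite !in_fsetU varschi.
  case/orP=> [/orP[/(fsubsetP Xs)|/(fsubsetP xsphi)]|] ->; by rewrite ?orbT.
have wfv' : nc_wf (NCTerm (U `&` (vars t `|` vars chi)) t chi).
  split=> //=.
    by apply/fsubsetP => x xchi; rewrite in_fsetI !in_fsetU xchi !orbT.
  by apply/fsubsetP => x; rewrite in_fsetI fsetUC => /andP[].
have wfD : nc_wf (NCTerm (U `&` (vars t `|` vars chi)) t psi).
  split=> //=.
    apply/fsubsetP => x; rewrite vars_conj in_fsetI !in_fsetU varschi.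
    by case/orP => ->; rewrite !orbT.
  rewrite EU; apply/fsubsetP => x; rewrite !(in_fsetU, in_fsetI, in_fsetD).
  by case/orP=> [/orP[/Et->|/andP[_ ->]]|/andP[_ ->]]; rewrite ?orbT.
(* [xi] itself witnesses the existential premise of the entailment. Only [zs] is then reassigned,
   and these rule variables do not occur in [phi], so [phi] stays satisfied. *)
have extend xi : valuation M xi -> sat M xi phi ->
    (forall x, x \in xs -> value M (xi x) /\ res (xi x) = vsort x) ->
  exists2 w, forall x, x \in zs -> value M (w x) /\ res (w x) = vsort x
    & sat M (override zs w xi) phi /\ sat M (override zs w xi) pig.
  move=> Hxi Hphi Hxs.
  have : sat_ex M xi xs phi.
    apply/sat_exP; exists xi => //; rewrite /sat -[RHS]Hphi.
    by apply: eq_eval => x _; rewrite /override if_same.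
  case/(Himp _ Hxi)/sat_exP => w Hw Hpig; exists w => //; split=> //.
  rewrite /sat -[RHS]Hphi; apply: eq_eval => x xphi; rewrite /override.
  by case: ifP => // /zsR/fresh[_]; rewrite xphi.
have satv : satisfiable M chi.
  case/sat_exP: Hsat0 => v Hv Hphi; have Hxi := override_valuation Hv Hxi0.
  have [|w Hw Hchi] := extend _ Hxi Hphi.
    by move=> x xxs; rewrite /override xxs; apply: Hv.
  have Hxi' := override_valuation Hw Hxi.
  by exists (override zs w (override xs v xi0)) => //; apply/satchi.
have [delta Hd Hfresh] :=
  fresh_renaming (enum_fset (rule_vars (Rule Z l r pi)))
                 (enum_fset (rule_vars (Rule Z l r pi) `|` (U `|` (vars s `|` vars chi)))).
have {}Hfresh x : x \in rule_vars (Rule Z l r pi) ->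
    delta x \notin rule_vars (Rule Z l r pi) /\
    delta x \notin U `|` (vars s `|` vars chi).
  by move=> /Hfresh dB; apply/andP; rewrite -negb_or -in_fsetU.
(* [gamma x] is never [delta x]: for [x] in [l], [delta x] would occur in [s]; otherwise [gamma x]
   is [x], whereas [delta x] avoids the rule's own variables. *)
have [] := @transport_substitution _ delta (rule_vars (Rule Z l r pi)) gamma Hd Hg.
  move=> x xR Ex; have [dR] := Hfresh x xR.
  rewrite 2!in_fsetU !negb_or => /and3P[_ ds _].
  have [xl|xl] := boolP (x \in vars l).
    case/negP: ds; apply: (fsubsetP (vars_subterm Hsp)); apply/vars_subst.
    by exists x; rewrite // Ex vars_Var.
  by move: Ex dR; rewrite gid // => -[<-]; rewrite xR.
move=> sigma [Hsig Hsdom Hsd].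
(* Thus the variant has the same redex, contractum and instantiated constraint as the most general
   step. *)
have Hsub u : vars u `<=` rule_vars (Rule Z l r pi) ->
    subst sigma (subst (fun x => Var (delta x)) u) = subst gamma u.
  move=> /fsubsetP Hu; rewrite subst_comp; apply: eq_subst => x /Hu xR /=.
  exact: Hsd.
have lR : vars l `<=` rule_vars (Rule Z l r pi).
  by rewrite /rule_vars -fsetUA fsubsetUl.
have rR : vars r `<=` rule_vars (Rule Z l r pi).
  by rewrite /rule_vars /= fsetUAC fsubsetUr.
have piR : vars pi `<=` rule_vars (Rule Z l r pi) by rewrite fsubsetUr.
exists (NCTerm U s chi), (NCTerm (U `&` (vars t `|` vars chi)) t chi), delta; split=> //.

(* Equivalence before the step *)
- split=> //=; last first.
    apply: (nc_sub_con Hxi0) => //=; [by case: wfC | exact: fsubsetUl |].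
    by move=> xi' Hxi' /(satchi _ Hxi')[].
  move=> tau Htau Hval /(models_ground _ Hxi0 Htau)[/= Hvphi Hphi].
  have HgX := ground_valuation Hxi0 Htau.
  have [|w Hw [Hwphi Hwpig]] := extend _ HgX Hphi.
    move=> x xxs; suff /(ground_in_Val xi0 Htau)[] : in_Val M (tau x) by [].
    by apply: Hval; rewrite /= in_fsetU xxs orbT.
  (* [zs] receives the values solving [pig]. The remaining extra variables may take any values,
     since only trivial equations constrain them; [xi0] provides some because [hEx] gives them
     theory sorts. *)
  pose tau' x := if x \in zs then App (w x) [::]
                 else if x \in E then App (xi0 x) [::] else tau x.
  have tau'Val x : x \in U -> in_Val M (tau' x).
    rewrite /tau'; case: ifP => [/Hw[]|nzs]; first by exists (w x).
    case: ifP => [/hEx/Hxi0[]|nE xU]; first by exists (xi0 x).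
    apply: Hval; move: xU; rewrite /U in_fsetU varschi => /orP[//|].
    by rewrite nE orbF => /orP[/phiU//|/varspig[|]]; rewrite ?nzs // in_fsetU => ->.
  have Htau' : substitution tau'.
    move=> x; rewrite /tau'; case: ifP => [/Hw[vw sw]|_].
      by have [_ aw] := valueP vw; rewrite /= aw sw.
    case: ifP => [/hEx/Hxi0[vw sw]|_]; last exact: Htau.
    by have [_ aw] := valueP vw; rewrite /= aw sw.
  (* All variables of [phi] and [pig] lie in this set. It meets [E] only inside [zs], where [w]
     takes precedence. *)
  have Eg : {in X `|` xs `|` zs, ground M xi0 tau' =1 override zs w (ground M xi0 tau)}.
    move=> x xU; rewrite /ground /override /tau'; case: ifP => [/Hw[->]//|nzs].
    move: xU; rewrite in_fsetU nzs orbF => xU.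
    by case: ifP => // /ER /(XphiR _ xU).
  exists tau'; split=> //.
    apply/(models_ground _ Hxi0 Htau'); split.
      by move=> x /= xchi; apply: tau'Val; rewrite in_fsetU xchi orbT.
    apply/satchi; first exact: ground_valuation.
    split; [rewrite /sat -[RHS]Hwphi | rewrite /sat -[RHS]Hwpig]; apply: eq_eval => x xv; apply: Eg.
      by rewrite in_fsetU phiU.
    by case: (varspig _ xv) => H; rewrite !in_fsetU H ?orbT.
  apply: eq_subst => x xins /=; rewrite /tau'.
  case: ifP => [/zsR/fresh[]|_]; first by rewrite xins.
  by case: ifP => [/ER/fresh[]|_] //; rewrite xins.

(* The rewrite step with the renamed variant *)
- split=> //.
  + exact: (constrained_rule_rename Hd hrho).
  + rewrite -/(rename_rule delta (Rule Z l r pi)) rule_vars_rename.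
    apply/fdisjointP => y /imfsetP[/= x xR ->].
    by case: (Hfresh x xR).
  + exists p, sigma; rewrite !Hsub //; split=> //.
    * by rewrite -/(rename_rule delta (Rule Z l r pi)) rule_vars_rename.
    * move=> y /imfsetP[/= x xZ ->]; have xR := fsubsetP ZV _ xZ; rewrite Hsd //.
      have [xl|xl] := boolP (x \in vars l).
        have [|v|[z zX ->]] := HZ x; [by rewrite in_fsetI xl | by left |].
        by right; exists z; rewrite // !in_fsetU zX.
      (* Outside [l] the instance is [x] itself, which must lie in [U]: the trivial equations put it
         there if [x] is in [r], and [pig] does if [x] is in [pi]. *)
      right; exists x; last exact: gid.
      rewrite in_fsetU varschi; apply/orP; right.
      move: xR; rewrite /rule_vars /= !in_fsetU (negPf xl) /= => /orP[xr|xpi].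
        by rewrite in_E xl xr !orbT.
      suff -> : x \in vars pig by rewrite orbT.
      by apply/vars_subst; exists x; rewrite // gid // vars_Var.
    * by move=> xi Hxi; apply/sat_impl => // /(satchi _ Hxi)[].

(* Equivalence after the step *)
- rewrite /rmv /= -EU; split=> //; apply: (nc_sub_con Hxi0) => //=.
  + by case: wfD.
  + by move=> xi' Hxi'; rewrite sat_conj_refl.
  + by case: wfv'.
  + by move=> xi' Hxi'; rewrite sat_conj_refl.
Qed.
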